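(* Let $(X,\kappa)$ be a rigid digital image, let $id:X\to X$ be the identity map, and let $i\geq 2$. Then $HCS(\underbrace{id,\ldots,id}_{i}) = HCS(\underbrace{id,\ldots,id}_{i+1}) = \{\#X\}$.
   Context: A digital image is a pair $(X,\kappa)$ with $X$ a finite subset of $\mathbb{Z}^n$ for some $n\in\mathbb{N}$ and $\kappa$ a symmetric, antireflexive (irreflexive) relation on $X$, called the adjacency. A function $f:(X,\kappa_1)\to(Y,\kappa_2)$ is (digitally) continuous if whenever $x,y\in X$ are $\kappa_1$-adjacent, $f(x)$ and $f(y)$ are equal or $\kappa_2$-adjacent (equivalently, images of connected subsets are connected). For $m$ a positive integer, $[0,m]_{\mathbb{Z}}=\{0,1,\ldots,m\}$ carries the adjacency in which $s,t$ are adjacent iff $|s-t|=1$. Continuous maps $f,g:X\to Y$ are (digitally) homotopic, written $f\simeq g$, if there are a positive integer $m$ and a function $H:X\times[0,m]_{\mathbb{Z}}\to Y$ such that $H(x,0)=f(x)$ and $H(x,m)=g(x)$ for all $x\in X$; for each $x\in X$ the map $t\mapsto H(x,t)$ from $[0,m]_{\mathbb{Z}}$ to $Y$ is continuous; and for each $t\in[0,m]_{\mathbb{Z}}$ the map $x\mapsto H(x,t)$ from $X$ to $Y$ is continuous. A continuous map is rigid if no continuous map other than itself is homotopic to it; the digital image $X$ is rigid if $id:X\to X$ is rigid. The coincidence point set is $C(g_1,\ldots,g_i)=\{x\in X : g_1(x)=\cdots=g_i(x)\}$, and the homotopy coincidence point spectrum of continuous maps $f_1,\ldots,f_i:X\to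 Y$ is $HCS(f_1,\ldots,f_i)=\{\#C(g_1,\ldots,g_i) : g_j:X\to Y \text{ continuous},\ g_j\simeq f_j \text{ for } j=1,\ldots,i\}$. $\#A$ denotes the cardinality of $A$. *)

(* Defs.v *)
From mathcomp Require Import all_boot all_order all_algebra.
From mathcomp Require Import finmap.
From mathcomp Require Import boolp classical_sets.

Set Implicit Arguments.
Unset Strict Implicit.
Unset Printing Implicit Defensive.

(* A finite subset of Z^n with an adjacency; the coercion [points] lets an image
   be used as the finite type of its own points. *)
Record digital_image := DigitalImage {
  dim : nat;
  points :> {fset 'rV[int]_dim};
  adj : rel points;
  adj_sym : symmetric adj;
  adj_irr : irreflexive adj }.

(* Continuity is stated for arbitrary carriers so that it applies both to
   digital images and to the interval [0, m]_Z. *)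
Definition dcontinuous (T U : Type) (eT : rel T) (eU : rel U) (f : T -> U) :
    Prop :=
  forall x y : T, eT x y -> f x = f y \/ eU (f x) (f y).

Definition interval_adj (m : nat) : rel 'I_m.+1 :=
  fun s t => (`|s%:Z - t%:Z| == 1)%R.

Definition homotopic (X Y : digital_image) (f g : X -> Y) : Prop :=
  exists m : nat, (0 < m)%N /\
  exists H : X -> 'I_m.+1 -> Y,
    [/\ forall x, H x ord0 = f x,
        forall x, H x ord_max = g x,
        forall x, dcontinuous (@interval_adj m) (@adj Y) (H x)
      & forall t, dcontinuous (@adj X) (@adj Y) (H^~ t)].

Definition rigid_map (X Y : digital_image) (f : X -> Y) : Prop :=
  dcontinuous (@adj X) (@adj Y) f /\
  forall g : X -> Y,
    dcontinuous (@adj X) (@adj Y) g -> homotopic g f -> g = f.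

Definition rigid (X : digital_image) : Prop := rigid_map (@id X).

Definition coincidence (X Y : digital_image) (i : nat) (g : 'I_i -> X -> Y) :
    {set X} :=
  [set x | [forall j, forall k, g j x == g k x]].

Definition HCS (X Y : digital_image) (i : nat) (f : 'I_i -> X -> Y) : set nat :=
  [set c | exists g : 'I_i -> X -> Y,
      (forall j, dcontinuous (@adj X) (@adj Y) (g j) /\ homotopic (g j) (f j))
      /\ c = #|coincidence g| ]%classic.

(* Main.v *)
Require Import Defs.
From mathcomp Require Import all_boot all_order all_algebra.
From mathcomp Require Import finmap.
From mathcomp Require Import boolp classical_sets.

Lemma homotopic_refl (X Y : digital_image) (f : X -> Y) :
  dcontinuous (@adj X) (@adj Y) f -> homotopic f f.
Proof.
(* The stationary homotopy, of the least length allowed. *)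
move=> cf; exists 1%N; split=> //; exists (fun x _ => f x).
by split=> // x s t _; left.
Qed.

Lemma coincidence_const (X Y : digital_image) (i : nat) (f : X -> Y) :
  coincidence (fun _ : 'I_i => f) = finset.setT.
Proof.
by apply/setP=> x; rewrite !inE; apply/forallP=> j; apply/forallP=> k.
Qed.

Lemma HCS_rigid (X Y : digital_image) (i : nat) (f : X -> Y) :
  rigid_map f -> HCS (fun _ : 'I_i => f) = [set #|` points X|%fset]%classic.
Proof.
move=> [cf rf]; rewrite cardfE.
apply/seteqP; split=> [c [g [hg ->]]|c ->] /=.
  (* Rigidity forces each component of the tuple to be [f]. *)
  suff -> : g = fun=> f by rewrite coincidence_const cardsT.
  by apply/funext=> j; have [cg /(rf _ cg)] := hg j.
(* The value is attained by the constant tuple, admissible since homotopy is reflexive. *)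
exists (fun=> f); split; last by rewrite coincidence_const cardsT.
by move=> j; split=> //; exact: homotopic_refl.
Qed.

Theorem proposition4p3 (X : digital_image) (i : nat) (hX : rigid X)
    (hi : (2 <= i)%N) :
  HCS (fun _ : 'I_i => @id X) = HCS (fun _ : 'I_i.+1 => @id X) /\
  HCS (fun _ : 'I_i.+1 => @id X) = [set #|` points X|%fset]%classic.
Proof. by rewrite !(HCS_rigid _ _ _ _ hX). Qed.
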